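(* Let $\alpha\in\mathbb{R}\setminus\mathbb{Q}$. Then $\underline{g}(\alpha)=2$ if $\alpha\sim\frac{1+\sqrt5}{2}$, and $\underline{g}(\alpha)=1$ otherwise.
   Context: On $\mathbb{T}=\mathbb{R}/\mathbb{Z}$ let $dist(x,y)=\min_{t\in\mathbb{Z}}|x-y-t|$. For integers $N\ge1$ and $0\le q\le N$ put $D_q(N)=\min\{dist(q\alpha,k\alpha): 0\le k\le N,k\ne q\}$, let $g(\alpha,N)$ be the number of distinct values among $D_0(N),\dots,D_N(N)$, and $\underline{g}(\alpha)=\liminf_{N\to\infty}g(\alpha,N)$. We write $\alpha\sim\beta$ if $\beta=\frac{a\alpha+b}{c\alpha+d}$ for some integers $a,b,c,d$ with $ad-bc=1$. *)

(* Defs.v *)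
From HB Require Import structures.
From mathcomp Require Import all_boot all_order all_algebra.
From mathcomp Require Import archimedean.
From mathcomp Require Import mathcomp_extra boolp classical_sets reals ereal.
From mathcomp Require Import topology normedtype sequences.

Set Implicit Arguments.
Unset Strict Implicit.
Unset Printing Implicit Defensive.

Import Order.TTheory GRing.Theory Num.Theory.

Local Open Scope classical_set_scope.
Local Open Scope ring_scope.

(* The two minima below are written with [inf]; [distP] and [DP] show that the
   infima are attained, i.e., that they are minima. *)

Definition dist {R : realType} (x y : R) : R :=
  inf [set `|x - y - t%:~R| | t in [set: int]].

Definition D {R : realType} (alpha : R) (N q : nat) : R :=
  inf [set dist (q%:R * alpha) (k%:R * alpha)
      | k in [set k : nat | (k <= N)%N /\ k <> q]].

Definition g {R : realType} (alpha : R) (N : nat) : nat :=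
  size (undup [seq D alpha N q | q <- iota 0 N.+1]).

(* The term at [N = 0], where [D] is the junk value [inf set0], is irrelevant
   to the limit inferior. *)
Definition g_liminf {R : realType} (alpha : R) : \bar R :=
  limn_einf (fun N : nat => ((g alpha N)%:R : R)%:E).

Definition sl2z_equiv {R : realType} (alpha beta : R) : Prop :=
  exists a b c d : int,
    [/\ a * d - b * c = 1,
        c%:~R * alpha + d%:~R != 0 &
        beta = (a%:~R * alpha + b%:~R) / (c%:~R * alpha + d%:~R)].

Lemma dist_le {R : realType} (x y : R) (t : int) :
  dist x y <= `|x - y - t%:~R|.
Proof.
apply: ge_inf; last by exists t.
by exists 0 => _ [s _ <-]; exact: normr_ge0.
Qed.

Lemma distP {R : realType} (x y : R) :
  exists t : int, dist x y = `|x - y - t%:~R|.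
Proof.
set z := x - y; set m := Num.floor z.
have /andP[mz zm] : m%:~R <= z < (m + 1)%:~R by exact: floor_itv.
pose d1 := `|z - m%:~R|; pose d2 := `|z - (m + 1)%:~R|.
have lb t : Num.min d1 d2 <= `|z - t%:~R|.
  have [tm|mt] := lerP t m.
    rewrite ge_min; apply/orP; left.
    have tm' : (t%:~R : R) <= m%:~R by rewrite ler_int.
    rewrite /d1 !ger0_norm ?subr_ge0 ?(le_trans tm' mz)//.
    by rewrite lerD2l lerN2.
  rewrite ge_min; apply/orP; right.
  have mt' : ((m + 1)%:~R : R) <= t%:~R by rewrite ler_int lezD1.
  rewrite /d2 !ler0_norm ?subr_le0 ?(ltW zm) ?(ltW (lt_le_trans zm mt'))//.
  by rewrite lerN2 lerD2l lerN2.
have min_le : Num.min d1 d2 <= dist x y.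
  by apply: lb_le_inf; [exists `|z - 0%:~R|, 0|move=> _ [t _ <-]; exact: lb].
have [d12|d21] := leP d1 d2; [exists m|exists (m + 1)]; apply/eqP;
  rewrite eq_le dist_le/= (le_trans _ min_le)// le_min lexx ?d12//.
by rewrite (ltW d21).
Qed.

Lemma D_le {R : realType} (alpha : R) (N q k : nat) :
  (k <= N)%N -> k <> q -> D alpha N q <= dist (q%:R * alpha) (k%:R * alpha).
Proof.
move=> kN kq; apply: ge_inf; last by exists k.
by exists 0 => _ [j _ <-]; have [t ->] := distP (q%:R * alpha) (j%:R * alpha).
Qed.

Lemma DP {R : realType} (alpha : R) (N q : nat) : (0 < N)%N ->
  exists k : nat, [/\ (k <= N)%N, k <> q &
    D alpha N q = dist (q%:R * alpha) (k%:R * alpha)].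
Proof.
move=> N0; pose F (k : 'I_N.+1) := dist (q%:R * alpha) (k%:R * alpha).
have [i0 i0q] : exists i : 'I_N.+1, val i != q.
  have [->|q0] := eqVneq q 0%N; last by exists ord0; rewrite eq_sym.
  by exists ord_max => /=; rewrite -lt0n.
case: (arg_minP F (P := fun i : 'I_N.+1 => val i != q) i0q) => i iq imin.
have iN : (i <= N)%N by rewrite -ltnS.
exists i; split=> //; first exact/eqP.
apply/eqP; rewrite eq_le D_le//=; last exact/eqP.
apply: lb_le_inf; first by exists (F i), i; split=> //; exact/eqP.
move=> _ [k [kN /eqP kq] <-].
by have := imin (Ordinal (kN : (k < N.+1)%N)) kq.
Qed.

(* Main.v *)
Require Import Defs.
From HB Require Import structures.
From mathcomp Require Import all_boot all_order all_algebra.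
From mathcomp Require Import boolp classical_sets reals ereal.
From mathcomp Require Import topology normedtype sequences.
From mathcomp Require Import archimedean zify ring lra.

(** Since [dist (q alpha) (k alpha)] depends only on [`|q - k|], [D alpha N q] is
    the least distance from [m alpha] to an integer over [1 <= m <= max(q, N - q)],
    a range of lengths between [N / 2] and [N]. Hence [g alpha N] is one plus the
    number of record denominators in [(ceil(N / 2), N]]. The records are the
    continued fraction denominators [q_k], with
    [q_(k+2) = q_k + a_(k+1) q_(k+1)]. At [N = q_k - 1] there is at most one
    such record, and there is none exactly when [2 q_(k-1) <= q_k]. So the lower
    limit is 1 if infinitely many partial quotients are at least 2, and 2
    otherwise; and the partial quotients are eventually 1 exactly when [alpha] is
    equivalent to the golden ratio. Determinant -1 is harmless, because one more
    step of the expansion changes the sign.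

    The expansion is run on pairs [(q, p), (q', p')] of successive approximations,
    from an arbitrary initial pair: for [alpha] equivalent to the golden ratio the
    initial pair is read off the unimodular matrix, and then all partial quotients
    are 1. *)

Import Order.TTheory GRing.Theory Num.Theory.

Local Open Scope ring_scope.

(** * Lower limits that are attained infinitely often *)

Lemma limn_einf_eq (R : realType) (u : nat -> \bar R) (c : \bar R) (n0 : nat) :
  (forall n, (n0 <= n)%N -> (c <= u n)%E) ->
  (forall n, exists2 m, (n <= m)%N & (u m <= c)%E) ->
  limn_einf u = c.
Proof.
move=> ule ufreq; rewrite limn_einf_lim.
have -> : limn (einfs u) = ereal_sup (range (einfs u)).
  by apply/cvg_lim => //; exact: cvg_einfs_sup.
apply/eqP; rewrite eq_le; apply/andP; split.
  apply: ge_ereal_sup => _ [n _ <-].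
  have [m nm um] := ufreq n.
  by apply: le_trans um; apply: ereal_inf_lbound; exists m.
apply: (@le_trans _ _ (einfs u n0)); last by apply: ereal_sup_ubound; exists n0.
by apply: le_ereal_inf_tmp => _ [p /= pm <-]; exact: ule.
Qed.

(** * Approximation errors and the continued fraction step *)

Definition err {R : realType} (alpha : R) (q p : int) : R :=
  q%:~R * alpha - p%:~R.

Lemma err_eq0 (R : realType) (alpha : R) (q p : int) :
  irrational alpha -> q != 0 -> err alpha q p != 0.
Proof.
move=> airr q0; apply/negP => /eqP e0; apply: airr.
exists (p%:~R / q%:~R) => //.
have q0' : (q%:~R : R) != 0 by rewrite intr_eq0.
rewrite fmorph_div/= !ratr_int; apply: (mulfI q0').
by move/eqP: e0; rewrite subr_eq0 => /eqP ->; field.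
Qed.

Lemma errD (R : realType) (alpha : R) (x y q p q' p' : int) :
  err alpha (x * q + y * q') (x * p + y * p') =
  x%:~R * err alpha q p + y%:~R * err alpha q' p'.
Proof. by rewrite /err !rmorphD/= !rmorphM/=; ring. Qed.

Record frame := Frame { fq : int; fp : int; fq' : int; fp' : int }.

Definition fdet (s : frame) : int := fq s * fp' s - fp s * fq' s.

Section frames.
Context {R : realType} (alpha : R).

Definition ferr (s : frame) : R := err alpha (fq s) (fp s).
Definition ferr' (s : frame) : R := err alpha (fq' s) (fp' s).

(** Abstract successive convergents: fractions on opposite sides of [alpha], the second with the
    smaller error, whose vectors form a basis of the integer lattice. *)
Definition reduced (s : frame) : Prop :=
  [/\ 0 < fq s, 0 < fq' s, fdet s = 1 \/ fdet s = -1,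
      ferr s * ferr' s < 0 & `|ferr' s| < `|ferr s| ].

(* In the basis given by the frame, [(m, n)] has coordinates of opposite signs,
   so the two contributions to [m * alpha - n] add up. *)
Lemma reduced_best {s : frame} {m : int} (n : int) :
  reduced s -> m != 0 -> `|m| < fq' s -> `|ferr s| <= `|err alpha m n|.
Proof.
move=> [q0 q'0 dets sgn _] m0 mq'.
(* Cramer's rule; [fdet s] is its own inverse, so it multiplies instead of dividing. *)
pose x := fdet s * (m * fp' s - n * fq' s).
pose y := fdet s * (fq s * n - fp s * m).
have mE : m = x * fq s + y * fq' s.
  have -> : x * fq s + y * fq' s = fdet s * fdet s * m.
    by rewrite /x /y /fdet; ring.
  by case: dets => ->; ring.
have nE : n = x * fp s + y * fp' s.
  have -> : x * fp s + y * fp' s = fdet s * fdet s * n.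
    by rewrite /x /y /fdet; ring.
  by case: dets => ->; ring.
have -> : err alpha m n = x%:~R * ferr s + y%:~R * ferr' s.
  by rewrite {1}mE {1}nE errD.
clearbody x y; clear dets nE.
have [y0|ynz] := eqVneq y 0.
  have x0 : x != 0 by apply: contraNneq m0 => x0; rewrite mE x0 y0 !mul0r.
  rewrite y0 mul0r addr0 normrM ler_peMl// -intr_norm -[1]/(1%:~R) ler_int.
  by rewrite -gtz0_ge1 normr_gt0.
have [[y1 x1]|[y1 x1]] : (1 <= y /\ x <= -1) \/ (y <= -1 /\ 1 <= x) by nia.
  have {}y1 : (1 : R) <= y%:~R by rewrite -[1]/(1%:~R) ler_int.
  have {}x1 : (x%:~R : R) <= -1 by rewrite -[-1]/((-1)%:~R) ler_int.
  case: (ltrgt0P (ferr s)) sgn => [p|p|->]; rewrite ?mul0r ?ltxx// => sgn.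
    by rewrite ler_normr; apply/orP; right; nra.
  by rewrite ler_normr; apply/orP; left; nra.
have {}y1 : (y%:~R : R) <= -1 by rewrite -[-1]/((-1)%:~R) ler_int.
have {}x1 : (1 : R) <= x%:~R by rewrite -[1]/(1%:~R) ler_int.
case: (ltrgt0P (ferr s)) sgn => [p|p|->]; rewrite ?mul0r ?ltxx// => sgn.
  by rewrite ler_normr; apply/orP; left; nra.
by rewrite ler_normr; apply/orP; right; nra.
Qed.

(** The argument of the floor is the complete quotient, which exceeds 1 on a reduced frame. *)
Definition pquo (s : frame) : int := Num.floor (- ferr s / ferr' s).

Definition fstep (s : frame) : frame :=
  Frame (fq' s) (fp' s) (fq s + pquo s * fq' s) (fp s + pquo s * fp' s).

Lemma fdet_step (s : frame) : fdet (fstep s) = - fdet s.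
Proof. by rewrite /fdet/=; ring. Qed.

Lemma ferr_step (s : frame) :
  ferr' (fstep s) = ferr s + (pquo s)%:~R * ferr' s.
Proof.
by have := errD _ alpha 1 (pquo s) (fq s) (fp s) (fq' s) (fp' s); rewrite !mul1r.
Qed.

Hypothesis alpha_irr : irrational alpha.

Lemma pquo_ge1 {s : frame} : reduced s -> 1 <= pquo s.
Proof.
move=> [_ _ _ sgn lt_err]; rewrite floor_ge_int.
have e'0 : ferr' s != 0 by apply: contraTneq sgn => ->; rewrite mulr0 ltxx.
case: (ltrgt0P (ferr' s)) sgn lt_err e'0 => // e' sgn; have [e|e] := leP 0 (ferr s).
- by nra.
- by rewrite (ltr0_norm e) => lt_err _; rewrite lter_pdivlMr// mul1r ltW.
- by rewrite (ger0_norm e) => lt_err _; rewrite lter_ndivlMr// mul1r; lra.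
- by nra.
Qed.

(** The new error is the remainder of [ferr s] modulo [ferr' s]: it keeps the sign of [ferr s], and
    irrationality keeps it from vanishing. *)
Lemma reduced_step {s : frame} : reduced s -> reduced (fstep s).
Proof.
move=> sr; have a1 := pquo_ge1 sr; move: (sr) => [q0 q'0 dets sgn lt_err].
have q''0 : 0 < fq s + pquo s * fq' s by nia.
split => //=; first by rewrite fdet_step; case: dets => ->; [right|left].
- have : ferr' (fstep s) != 0 by apply: err_eq0 => //=; rewrite gt_eqF.
  rewrite ferr_step -[ferr (fstep s)]/(ferr' s).
  have /andP[] := floor_itv (- ferr s / ferr' s); rewrite -/(pquo s) rmorphD/=.
  case: (ltrgt0P (ferr' s)) sgn lt_err => [e' sgn|e' sgn|->]; rewrite ?mulr0 ?ltxx//.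
    rewrite ler_pdivlMr// ltr_pdivrMr// => lt_err le_a lt_a e''0.
    rewrite pmulr_rlt0// lt_neqAle e''0; lra.
  rewrite ler_ndivlMr// ltr_ndivrMr// => lt_err le_a lt_a e''0.
  rewrite nmulr_rlt0// lt_neqAle eq_sym e''0; lra.
- rewrite ferr_step -[ferr (fstep s)]/(ferr' s).
  have /andP[] := floor_itv (- ferr s / ferr' s); rewrite -/(pquo s) rmorphD/=.
  case: (ltrgt0P (ferr' s)) sgn lt_err => [e' sgn|e' sgn|->]; rewrite ?mulr0 ?ltxx//.
    rewrite ler_pdivlMr// ltr_pdivrMr// => lt_err le_a lt_a.
    by rewrite ltr_norml; apply/andP; split; lra.
  rewrite ler_ndivlMr// ltr_ndivrMr// => lt_err le_a lt_a.
  by rewrite ltr_norml; apply/andP; split; lra.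
Qed.

End frames.

(** * Bounds for the number of distinct values *)

Lemma g_ge1 (R : realType) (alpha : R) (N : nat) : (1 <= g alpha N)%N.
Proof.
rewrite /g -has_predT; apply/hasP; exists (D alpha N 0) => //.
by rewrite mem_undup/= inE eqxx.
Qed.

Lemma g_le_size (R : realType) (alpha : R) (N : nat) (s : seq R) :
  (forall q, (q <= N)%N -> D alpha N q \in s) -> (g alpha N <= size s)%N.
Proof.
move=> Ds; apply: uniq_leq_size; first exact: undup_uniq.
move=> x; rewrite mem_undup => /mapP[q]; rewrite mem_iota add0n ltnS => qN ->.
exact: Ds.
Qed.

Lemma g_ge2 (R : realType) (alpha : R) (N q r : nat) :
  (q <= N)%N -> (r <= N)%N -> D alpha N q != D alpha N r ->
  (2 <= g alpha N)%N.
Proof.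
move=> qN rN qr; apply: (@uniq_leq_size _ [:: D alpha N q; D alpha N r]).
  by rewrite /= inE qr.
by move=> x; rewrite !inE mem_undup => /orP[] /eqP ->; apply: map_f;
  rewrite mem_iota add0n ltnS.
Qed.

(** * Record denominators and the values of [D] *)

Section records.
Context {R : realType} (alpha : R) (s0 : frame).
Hypotheses (alpha_irr : irrational alpha) (s0_red : reduced alpha s0).

Definition fseq (k : nat) : frame := iter k (fstep alpha) s0.
(** The shift drops the first denominator of [s0], which may equal or exceed the second; the others
    increase strictly. *)
Definition rden (k : nat) : nat := `|fq (fseq k.+1)|%N.
Definition rerr (k : nat) : R := `|ferr alpha (fseq k.+1)|.

Lemma fseq_reduced (k : nat) : reduced alpha (fseq k).
Proof. by elim: k => // k; exact: reduced_step. Qed.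

Lemma rdenE (k : nat) : (rden k)%:Z = fq (fseq k.+1).
Proof. by rewrite /rden gez0_abs//; have [/ltW] := fseq_reduced k.+1. Qed.

Lemma rdenS (k : nat) : (rden k.+1)%:Z = fq' (fseq k.+1).
Proof. exact: rdenE. Qed.

Lemma rden_rec (k : nat) :
  (rden k.+2)%:Z = (rden k)%:Z + pquo alpha (fseq k.+1) * (rden k.+1)%:Z.
Proof. by rewrite rdenE rdenE rdenS. Qed.

Lemma rden_ltS (k : nat) : (rden k < rden k.+1)%N.
Proof.
rewrite -ltz_nat rdenS rdenE.
have := pquo_ge1 alpha (fseq_reduced k); have [q0 q'0 _ _ _] := fseq_reduced k.
rewrite /= -/(fseq k); nia.
Qed.

Lemma rden_gt (k : nat) : (k < rden k)%N.
Proof.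
elim: k => [|k kr]; last exact: leq_ltn_trans kr (rden_ltS k).
by rewrite -ltz_nat rdenE; have [] := fseq_reduced 1.
Qed.

Lemma rden_addS (k : nat) : (rden k + rden k.+1 <= rden k.+2)%N.
Proof.
have := rden_rec k; have := pquo_ge1 alpha (fseq_reduced k.+1).
by nia.
Qed.

Lemma rden_double (k : nat) : 2 <= pquo alpha (fseq k.+1) ->
  (2 * rden k.+1 <= rden k.+2)%N.
Proof. by have := rden_rec k; nia. Qed.

Lemma rden_lt_double (k : nat) : pquo alpha (fseq k.+1) = 1 ->
  (rden k.+2 < 2 * rden k.+1)%N.
Proof. by have := rden_rec k; have := rden_ltS k; nia. Qed.

Lemma rerr_ltS (k : nat) : rerr k.+1 < rerr k.
Proof. by have [] := fseq_reduced k.+1. Qed.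

(** One of [q - rden k] and [q + rden k] lies between 0 and [N] and serves as competitor. *)
Lemma D_le_rerr (N q k : nat) :
  (q <= N)%N -> (rden k <= maxn q (N - q))%N -> D alpha N q <= rerr k.
Proof.
move=> qN; rewrite leq_max /rerr /ferr /err -rdenE => /orP[] rk.
  apply: le_trans (@D_le _ alpha N q (q - rden k) _ _) _; [lia| |].
    by have := rden_gt k; lia.
  apply: le_trans (dist_le _ _ (fp (fseq k.+1))) _.
  rewrite natrB// le_eqVlt; apply/orP; left; apply/eqP; congr `| _ |.
  by rewrite -(pmulrn 1 (rden k)); ring.
apply: le_trans (@D_le _ alpha N q (q + rden k) _ _) _; [lia| |].
  by have := rden_gt k; lia.
apply: le_trans (dist_le _ _ (- fp (fseq k.+1))) _.
rewrite natrD rmorphN/= opprK -[X in _ <= X]normrN.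
rewrite le_eqVlt; apply/orP; left; apply/eqP; congr `| _ |.
by rewrite -(pmulrn 1 (rden k)); ring.
Qed.

(** Every competitor differs from [q] by a nonzero integer of absolute value below [rden k.+1], so
    [reduced_best] applies. *)
Lemma D_ge_rerr (N q k : nat) : (0 < N)%N ->
  (q <= N)%N -> (maxn q (N - q) < rden k.+1)%N -> rerr k <= D alpha N q.
Proof.
move=> N0 qN; rewrite gtn_max => /andP[q1 q2].
have [j [jN jq ->]] := DP alpha q N0.
have [t ->] := distP (q%:R * alpha) (j%:R * alpha).
have -> : q%:R * alpha - j%:R * alpha - t%:~R =
          err alpha (q%:Z - j%:Z) t by rewrite /err rmorphB/= mulrBl.
by apply: reduced_best (fseq_reduced k.+1) _ _; rewrite -?rdenS; lia.
Qed.

Lemma D_eq_rerr (N q k : nat) : (0 < N)%N -> (q <= N)%N ->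
  (rden k <= maxn q (N - q) < rden k.+1)%N -> D alpha N q = rerr k.
Proof.
move=> N0 qN /andP[le_k lt_k].
by apply/eqP; rewrite eq_le D_le_rerr//= D_ge_rerr.
Qed.

(** For this [N], [rden_addS] gives [2 * rden k <= N], so [maxn q (N - q)] is at least [rden k] and
    only two records compete. *)
Lemma g_rden_le2 (k : nat) : (g alpha (rden k.+2).-1 <= 2)%N.
Proof.
have := rden_ltS k; have := rden_gt k; have := rden_ltS k.+1; have := rden_addS k.
move=> le_add lt1 gtk lt0.
apply: (g_le_size _ _ _ [:: rerr k; rerr k.+1]) => q qN; rewrite !inE.
have [le_max|lt_max] := leqP (rden k.+1) (maxn q ((rden k.+2).-1 - q)).
  by rewrite (@D_eq_rerr _ _ k.+1) ?eqxx ?orbT//; lia.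
by rewrite (@D_eq_rerr _ _ k) ?eqxx//; lia.
Qed.

(** Half of this [N], rounded up, is already at least [rden k]. *)
Lemma g_rden_le1 (k : nat) : (2 * rden k <= rden k.+1)%N ->
  (g alpha (rden k.+1).-1 <= 1)%N.
Proof.
move=> dbl; have := rden_gt k; have := rden_ltS k => lt0 gtk.
apply: (g_le_size _ _ _ [:: rerr k]) => q qN; rewrite !inE.
by rewrite (@D_eq_rerr _ _ k) ?eqxx//; lia.
Qed.

Lemma g_eventually_ge2 (k0 : nat) :
  (forall k, (k0 <= k)%N -> (rden k.+1 < 2 * rden k)%N) ->
  forall N, (rden k0.+1 <= N)%N -> (2 <= g alpha N)%N.
Proof.
move=> nodbl N leN.
have [k] : exists k, [&& (k0 < k)%N, (rden k <= N)%N & (N < rden k.+1)%N].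
  have exk : exists k, (N < rden k)%N by exists N; exact: rden_gt.
  case: (ex_minnP exk) => -[|k] ltN min_k.
    have homo : {homo rden : i j / (i < j)%N}.
      by apply: homo_ltn; [exact: ltn_trans|exact: rden_ltS].
    by have := homo 0%N k0.+1 isT; lia.
  exists k; rewrite ltN andbT.
  have leN' : (rden k <= N)%N by rewrite leqNgt; apply/negP => /min_k; rewrite ltnn.
  rewrite leN' andbT ltnNge; apply/negP => kk0.
  have homo : {homo rden : i j / (i <= j)%N}.
    by apply: homo_leq => // [|i]; [exact: leq_trans|exact/ltnW/rden_ltS].
  by have := homo k.+1 k0.+1 kk0; lia.
case: k => // k /and3P[k0k le_k lt_k].
have := rden_gt k.+1; have := nodbl k.+1 (ltnW k0k) => dbl gtk.
(* The longest range, at [q = N], reaches [rden k.+1]; the shortest, at [uphalf N], does not, since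
   [N < rden k.+2 < 2 * rden k.+1]. *)
apply: (@g_ge2 _ _ _ N (uphalf N)); [lia|lia|].
rewrite (@D_eq_rerr _ _ k.+1); [|lia|lia|lia].
rewrite lt_eqF//; apply: lt_le_trans (rerr_ltS k) _.
by apply: D_ge_rerr; lia.
Qed.

Lemma g_liminf_eq2 (k0 : nat) :
  (forall k, (k0 <= k)%N -> (rden k.+1 < 2 * rden k)%N) ->
  g_liminf alpha = (2%:R : R)%:E.
Proof.
move=> nodbl; apply: (@limn_einf_eq _ _ _ (rden k0.+1)) => [N leN|n].
  by rewrite lee_fin ler_nat; exact: g_eventually_ge2 leN.
exists (rden n.+2).-1; first by have := rden_gt n.+2; lia.
by rewrite lee_fin ler_nat g_rden_le2.
Qed.

Lemma g_liminf_eq1 :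
  (forall n, exists2 k, (n <= k)%N & (2 * rden k <= rden k.+1)%N) ->
  g_liminf alpha = (1 : R)%:E.
Proof.
move=> dbl; apply: (@limn_einf_eq _ _ _ 0) => [N _|n].
  by rewrite lee_fin (ler_nat R 1) g_ge1.
have [k nk dblk] := dbl n.
exists (rden k.+1).-1; first by have := rden_gt k.+1; lia.
by rewrite lee_fin (ler_nat R _ 1) g_rden_le1.
Qed.

End records.

(** * The golden ratio *)

Section golden.
Context {R : realType}.

Definition phi : R := (1 + Num.sqrt 5%:R) / 2%:R.

Lemma phi_sqr : phi * phi = phi + 1.
Proof.
have s5 : Num.sqrt 5%:R * Num.sqrt 5%:R = 5%:R :> R.
  by rewrite -expr2 sqr_sqrtr// ler0n.
by rewrite /phi; field: s5.
Qed.

Lemma phi_bounds : 3 / 2 <= phi < 2.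
Proof.
have s50 : 0 <= Num.sqrt 5%:R :> R := sqrtr_ge0 _.
have p0 : 0 < phi by rewrite /phi; lra.
by have sq := phi_sqr; apply/andP; split; nra.
Qed.

Variable alpha : R.
Hypothesis alpha_irr : irrational alpha.

(** The complete quotient is [phi]. Signs of the denominators are left free, so that a unimodular
    matrix yields such a frame directly. *)
Definition golden (s : frame) : Prop :=
  [/\ fdet s = 1 \/ fdet s = -1, ferr' alpha s != 0 &
      ferr alpha s = - phi * ferr' alpha s].

Lemma golden_pquo {s : frame} : golden s -> pquo alpha s = 1.
Proof.
move=> [_ e'0 eE]; apply: floor_def; rewrite eE -mulNr opprK mulfK//.
by rewrite rmorphD/=; have := phi_bounds; lra.
Qed.

(** Since [phi = 1 + 1 / phi], the next complete quotient is again [phi]. *)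
Lemma golden_step {s : frame} : golden s -> golden (fstep alpha s).
Proof.
move=> gs; have a1 := golden_pquo gs; move: gs => [dets e'0 eE].
have e''E : ferr' alpha (fstep alpha s) = (1 - phi) * ferr' alpha s.
  by rewrite ferr_step a1 eE; ring.
split; first by rewrite fdet_step; case: dets => ->; [right|left].
  rewrite e''E mulf_neq0//; have := phi_bounds.
  by move=> /andP[pl _]; rewrite subr_eq0 lt_eqF//; lra.
rewrite e''E -[ferr _ (fstep _ _)]/(ferr' alpha s) mulrA.
have -> : - phi * (1 - phi) = phi * phi - phi by ring.
by rewrite phi_sqr; ring.
Qed.

Definition fopp (s : frame) : frame := Frame (- fq s) (- fp s) (- fq' s) (- fp' s).

Lemma golden_opp {s : frame} : golden s -> golden (fopp s).
Proof.
have errN q p : err alpha (- q) (- p) = - err alpha q p.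
  by rewrite /err !rmorphN/=; ring.
move=> [dets e'0 eE]; split; last by rewrite /ferr /ferr' !errN mulrN -eE.
- by rewrite /fdet/= !mulrNN.
- by rewrite /ferr' errN oppr_eq0.
Qed.

Lemma golden_reduced {s : frame} :
  golden s -> 0 < fq s -> 0 < fq' s -> reduced alpha s.
Proof.
move=> [dets e'0 eE] q0 q'0; have /andP[pl _] := phi_bounds.
split => //; rewrite eE.
  by rewrite -mulrA mulNr oppr_lt0 pmulr_rgt0 -?expr2 ?exprn_even_gt0//=; lra.
by rewrite normrM normrN ltr_pMl ?normr_gt0// gtr0_norm; lra.
Qed.

Lemma golden_pos_of_same_sign {s : frame} : golden s -> 0 < fq s * fq' s ->
  exists s', [/\ golden s', 0 < fq s' & 0 < fq' s'].
Proof.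
move=> gs; have [q0|q0] := ltP 0 (fq s) => qq'.
  by exists s; rewrite pmulr_rgt0 in qq'.
have {}q0 : fq s < 0.
  by rewrite lt_neqAle q0 andbT; apply: contraTneq qq' => ->; rewrite mul0r ltxx.
exists (fopp s); rewrite nmulr_rgt0// in qq'.
by split; rewrite ?oppr_gt0//; exact: golden_opp.
Qed.

(* If the denominators [q] and [q'] have opposite signs, then either
   [q'] and [q + q'] have the same sign or [`|q + q'| < `|q| ]. *)
Lemma golden_pos {s : frame} : golden s ->
  exists s', [/\ golden s', 0 < fq s' & 0 < fq' s'].
Proof.
have [n] := ubnP (absz (fq s) + absz (fq' s)); elim: n s => // n IH s lt_n gs.
have [same|nsame] := ltP 0 (fq s * fq' s); first exact: golden_pos_of_same_sign same.
have stepE t : golden t -> fq' (fstep alpha t) = fq t + fq' t.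
  by move=> gt; rewrite /= golden_pquo// mul1r.
have gs1 := golden_step gs; have gs2 := golden_step gs1.
have e1 := stepE _ gs; have := stepE _ gs1.
rewrite e1 -[fq (fstep _ s)]/(fq' s) => e2.
have det0 : fq s != 0 \/ fq' s != 0.
  have [q0|] := eqVneq (fq s) 0; last by left.
  by right; apply/eqP => q'0; case: gs => -[] + _ _; rewrite /fdet q0 q'0 mul0r mulr0.
have [qq|qq] := ltP 0 (fq' s * (fq s + fq' s)).
  by apply: (golden_pos_of_same_sign gs1); rewrite e1.
have [q0|q0] := eqVneq (fq s) 0; first by nia.
(* Here one step does not lower the measure, but after two steps both denominators equal [fq s]. *)
have [q'0|q'0] := eqVneq (fq' s) 0.
  apply: (golden_pos_of_same_sign gs2); rewrite e2.
  by rewrite -[fq (fstep _ (fstep _ _))]/(fq' (fstep alpha s)) e1; nia.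
by apply: (IH _ _ gs1); rewrite e1 -[fq (fstep _ s)]/(fq' s); nia.
Qed.

(** Numerator and denominator of the Moebius transform are errors, up to a sign that turns the ratio
    [phi] into [- phi]. *)
Lemma golden_of_sl2z : sl2z_equiv alpha phi -> exists s, golden s.
Proof.
move=> [a [b [c [d [det1 den0 phiE]]]]].
exists (Frame a (- b) (- c) d).
have e'E : err alpha (- c) d = - (c%:~R * alpha + d%:~R).
  by rewrite /err rmorphN/=; ring.
split; first by left; rewrite /fdet/= -det1; ring.
  by rewrite /ferr'/= e'E oppr_eq0.
by rewrite /ferr /ferr'/= e'E mulrNN phiE divfK// /err rmorphN/= opprK.
Qed.

Lemma sl2z_of_golden {s : frame} : golden s -> sl2z_equiv alpha phi.
Proof.
wlog det1 : s / fdet s = 1 => [H gs|[_ e'0 eE]].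
  case: (gs) => -[det1|det1] _ _; first exact: H det1 gs.
  by apply: (H (fstep alpha s)); [rewrite fdet_step det1|exact: golden_step].
exists (- fq s), (fp s), (fq' s), (- fp' s).
have e'E : (fq' s)%:~R * alpha + (- fp' s)%:~R = ferr' alpha s.
  by rewrite rmorphN.
rewrite e'E; split => //; first by rewrite -det1 /fdet; ring.
have -> : (- fq s)%:~R * alpha + (fp s)%:~R = - ferr alpha s.
  by rewrite /ferr /err rmorphN/=; ring.
by rewrite eE -mulNr opprK mulfK.
Qed.

(* [ferr + phi * ferr'] is multiplied by [phi] at each step, but stays bounded. *)
Lemma golden_of_pquo1 {s : frame} : reduced alpha s ->
  (forall k, pquo alpha (fseq alpha s k) = 1) -> golden s.
Proof.
move=> sr a1; have /andP[pl pu] := phi_bounds.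
pose v k := ferr alpha (fseq alpha s k) + phi * ferr' alpha (fseq alpha s k).
have vS k : v k.+1 = phi * v k.
  rewrite /v /= -/(fseq alpha s k) ferr_step a1.
  rewrite -[ferr _ (fstep _ _)]/(ferr' alpha (fseq alpha s k)).
  have -> (x y : R) : phi * (x + phi * y) = phi * x + (phi * phi) * y by ring.
  by rewrite phi_sqr; ring.
(* Bernoulli's inequality, from [3 / 2 <= phi]. *)
have v_ge k : (1 + k%:R / 2) * `|v 0| <= `|v k|.
  elim: k => [|k IH]; first by rewrite mul0r addr0 mul1r.
  rewrite vS normrM gtr0_norm; last lra.
  have v0 := normr_ge0 (v 0).
  have kv0 : 0 <= k%:R * `|v 0| by rewrite mulr_ge0.
  have : 3 / 2 * `|v k| <= phi * `|v k| by rewrite ler_wpM2r.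
  by rewrite -natr1; nra.
have err_le k : `|ferr alpha (fseq alpha s k)| <= `|ferr alpha s|.
  elim: k => // k; apply: le_trans.
  by have [_ _ _ _ /ltW] := fseq_reduced alpha s alpha_irr sr k.
(* The constant bounds [1 + phi]. *)
have v_le k : `|v k| <= 3 * `|ferr alpha s|.
  have [_ _ _ _ lt_e] := fseq_reduced alpha s alpha_irr sr k.
  apply: le_trans (ler_normD _ _) _; rewrite normrM gtr0_norm; last lra.
  by have := err_le k; have := normr_ge0 (ferr' alpha (fseq alpha s k)); nra.
have v00 : v 0 = 0.
  apply/eqP; apply: contraT => v0; have {}v0 : 0 < `|v 0| by rewrite normr_gt0.
  (* With 6, [k / 2] times [|v 0|] exceeds the bound in [v_le]. *)
  have C0 : 0 <= 6 * `|ferr alpha s| / `|v 0| by rewrite divr_ge0// mulr_ge0.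
  set k := Num.bound (6 * `|ferr alpha s| / `|v 0|).
  have := archi_boundP C0; rewrite -/k ltr_pdivrMr// => lt_k.
  by have := v_ge k; have := v_le k; nra.
have [_ q'0 dets sgn _] := sr.
split => //; first by apply: err_eq0 => //; rewrite gt_eqF.
by apply/eqP; rewrite mulNr -addr_eq0; apply/eqP.
Qed.

(** The two integers enclosing [alpha], over denominator 1, form the frame, the farther one
    first. *)
Lemma exists_reduced : exists s, reduced alpha s.
Proof.
have /andP[ml mu] := floor_itv alpha; set m := Num.floor alpha in ml mu.
have m0 : err alpha 1 m != 0 by exact: err_eq0.
(* Excludes a tie between the two errors. *)
have m12 : err alpha 2 (2 * m + 1) != 0 by exact: err_eq0.
move: m0 m12; rewrite /err !rmorphD/= !rmorphM/= rmorph1 mul1r => m0 m12.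
rewrite rmorphD/= in mu.
have {}ml : 0 < alpha - m%:~R by rewrite lt_neqAle eq_sym m0; lra.
have E1 : `|alpha - m%:~R| = alpha - m%:~R by rewrite gtr0_norm.
have E2 : `|alpha - (m%:~R + 1%:~R)| = m%:~R + 1 - alpha.
  by rewrite ltr0_norm; lra.
have [lt1|le2] := ltP (alpha - m%:~R) (m%:~R + 1 - alpha).
  exists (Frame 1 (m + 1) 1 m); split => //.
  - by right; rewrite /fdet/=; ring.
  - by rewrite /ferr /ferr' /err/= !rmorphD/= mul1r; nra.
  - by rewrite /ferr /ferr' /err/= !rmorphD/= mul1r E1 E2.
exists (Frame 1 m 1 (m + 1)); split => //.
- by left; rewrite /fdet/=; ring.
- by rewrite /ferr /ferr' /err/= !rmorphD/= mul1r; nra.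
- rewrite /ferr /ferr' /err/= !rmorphD/= mul1r E1 E2 lt_neqAle le2 andbT.
  apply: contraNneq m12 => e; apply/eqP; lra.
Qed.

End golden.

Theorem theorem6 (R : realType) (alpha : R) (alpha_irr : irrational alpha) :
  (sl2z_equiv alpha ((1 + Num.sqrt 5%:R) / 2%:R) ->
     g_liminf alpha = (2%:R : R)%:E) /\
  (~ sl2z_equiv alpha ((1 + Num.sqrt 5%:R) / 2%:R) ->
     g_liminf alpha = (1 : R)%:E).
Proof.
split=> [/golden_of_sl2z[_ /golden_pos[s [gs q0 q'0]]]|not_sl2z].
  have sr := golden_reduced _ gs q0 q'0.
  have gseq k : golden alpha (fseq alpha s k).
    by elim: k => // k; exact: golden_step.
  apply: (g_liminf_eq2 alpha s alpha_irr sr 1) => -[//|k] _.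
  by apply: rden_lt_double => //; exact: golden_pquo.
have [s sr] := exists_reduced alpha alpha_irr.
apply: (g_liminf_eq1 alpha s alpha_irr sr) => n.
(* If no doubling occurs from index [n] on, all partial quotients from frame [n.+1] on are 1, which
   makes that frame golden. *)
apply: contrapT => nodbl; apply: not_sl2z.
apply: (@sl2z_of_golden _ _ (fseq alpha s n.+1)).
apply: golden_of_pquo1 => //; first exact: fseq_reduced.
move=> k; rewrite /fseq -iterD addnS -/(fseq alpha s _).
apply/eqP; rewrite eq_le pquo_ge1 ?andbT; last exact: fseq_reduced.
rewrite leNgt; apply/negP => a2; apply: nodbl; exists (k + n).+1; first lia.
by apply: rden_double => //; lia.
Qed.
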